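(* There are adjunctions between $\mathbf{Frob}(\mathbf{Rel})^{\mathrm{func}}$ and $\mathbf{Hstar}(\mathbf{Rel})^{\mathrm{func}}$, between $\mathbf{Frob}(\mathbf{Rel})$ and $\mathbf{Hstar}(\mathbf{Rel})$, and between $\mathbf{Frob}(\mathbf{Rel})^{\mathrm{rel}}$ and $\mathbf{Hstar}(\mathbf{Rel})^{\mathrm{rel}}$, in each case with right adjoint the functor from the $\mathbf{Hstar}$-category to the $\mathbf{Frob}$-category. Explicitly, the right adjoints map a relative H*-algebra $(X,m)$ to $(X/{\sim},m')$, where $\sim$ is the equivalence relation generated by $f\sim g$ if $f^2=f$ and $g^2=g$ and $gf$ is defined, and $m'([g],[f])=[m(g,f)]$.
   Context: $\mathbf{Rel}$ is the category of sets and relations: morphisms $r\colon X\to Y$ are subsets of $X\times Y$, with relational composition, converse $r^\dagger$, monoidal product $\times$ given by Cartesian product of sets, and $1$ denoting identities and the one-point set; coherence isomorphisms are suppressed. A relation has a right adjoint (for the order $\subseteq$) iff it is the graph of a function. For a relation $m\colon X\times X\to X$ consider: (F) $(1\times m)\circ(m^\dagger\times 1)=m^\dagger\circ m=(m\times 1)\circ(1\times m^\dagger)$; (M) $m\circ m^\dagger=1$; (A) $m\circ(1\times m)=m\circ(m\times 1)$; (U) there is $u\colon 1\to X$ with $m\circ(u\times 1)=1=m\circ(1\times u)$ (such $u$ is unique); (H) there is an involution $*$ on $\mathbf{Rel}(1,X)$ such that $m\circ(1\times x^* )=(1\times x^\dagger)\circ m^\dagger$ and $m\circ(x^*\times 1)=(x^\dagger\times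 1)\circ m^\dagger$ for all $x\colon 1\to X$. A relative Frobenius algebra is $(X,m)$ satisfying (F), (M), (A), (U). A relative H*-algebra is $(X,m)$ satisfying (M), (A), (H). By (M), $m$ is single-valued; write $m(h,g)=hg=f$ for $((h,g),f)\in m$. A pseudoinverse of $f\in X$ is $f^*\in X$ with $f=ff^*f$ and $f^*=f^*ff^*$. For a relation $r\colon X\to Y$ consider: (R) $r=\{(xx',yy')\mid(x,y),(x',y')\in r,\ xx'\text{ and }yy'\text{ defined}\}$; (P) $r\circ m_X=m_Y\circ(r\times r)$; (I) (for Frobenius algebras) $(r\times\eta^\dagger)\circ(m_X^\dagger\times 1)\circ(u_X\times 1)=(u_Y^\dagger\times 1)\circ(m_Y\times 1)\circ(r\times\eta)$, where $\eta=\{( *,(z,z))\mid z\in Z\}\colon 1\to Z\times Z$ for the relevant set $Z$; (I') (for H*-algebras) $(x,y)\in r$ iff $(x^*,y^* )\in r$, for any pseudoinverses $x^*$ of $x$ and $y^*$ of $y$. Objects of the $\mathbf{Frob}$-categories are relative Frobenius algebras; morphisms $(X,m_X)\to(Y,m_Y)$ are relations $r\colon X\to Y$ satisfying: (R) and (I) in $\mathbf{Frob}(\mathbf{Rel})^{\mathrm{rel}}$; (P) and (I) in $\mathbf{Frob}(\mathbf{Rel})$; (P), (I), having a right adjoint, and $r\circ u_X\subseteq u_Y$ in $\mathbf{Frob}(\mathbf{Rel})^{\mathrm{func}}$. Objects of the $\mathbf{Hstar}$-categories are relative H*-algebras; morphisms are relations satisfying: (R) and (I') in $\mathbf{Hstar}(\mathbf{Rel})^{\mathrm{rel}}$;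 (P) and (I') in $\mathbf{Hstar}(\mathbf{Rel})$; (P), (I') and having a right adjoint in $\mathbf{Hstar}(\mathbf{Rel})^{\mathrm{func}}$. Composition is that of $\mathbf{Rel}$.
   Formalization: Relations satisfying (R) are not closed under composition, so the two ''rel'' categories are not categories; for them the adjunction (functors, natural unit, hom-set bijection) is stated without the claim that composites of morphisms are morphisms. *)

(* Defs.v *)
From mathcomp Require Import all_boot.
From mathcomp Require Import boolp classical_sets functions.
From Stdlib Require Import Relation_Operators.

Set Implicit Arguments.
Unset Strict Implicit.
Unset Printing Implicit Defensive.

Local Open Scope classical_set_scope.
Local Open Scope relation_scope.

(* A morphism X -> Y of Rel is a set (X * Y). In relation_scope, [s \; r] is the
   composite "s after r" and [r^-1] is the converse. The identity relation is
   [diagonal] and the one-point set is [unit]. *)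

Definition tens (X X' Y Y' : Type) (r : set (X * Y)) (s : set (X' * Y')) :
    set ((X * X') * (Y * Y')) :=
  [set p | r (p.1.1, p.2.1) /\ s (p.1.2, p.2.2)].

Notation "r ⊗ s" := (tens r s) (at level 40, left associativity) :
  relation_scope.

Definition graph (X Y : Type) (f : X -> Y) : set (X * Y) :=
  [set p | f p.1 = p.2].

Definition assoc {X Y Z : Type} : set (((X * Y) * Z) * (X * (Y * Z))) :=
  graph (fun p => (p.1.1, (p.1.2, p.2))).
Definition lunit {X : Type} : set ((unit * X) * X) := graph snd.
Definition runit {X : Type} : set ((X * unit) * X) := graph fst.

Definition eta (Z : Type) : set (unit * (Z * Z)) := [set p | p.2.1 = p.2.2].
Arguments eta : clear implicits.

Definition has_right_adjoint (X Y : Type) (r : set (X * Y)) : Prop :=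
  exists s : set (Y * X), diagonal `<=` s \; r /\ r \; s `<=` diagonal.

(* [mulrel ((h, g), f)] reads "hg is defined and equal to f". *)
Record relMagma := RelMagma {
  carrier :> Type;
  mulrel : set ((carrier * carrier) * carrier)
}.
Arguments mulrel : clear implicits.

Definition axF (X : relMagma) : Prop :=
  let m := mulrel X in
  (diagonal ⊗ m) \; assoc \; (m^-1 ⊗ diagonal) = m^-1 \; m /\
  m^-1 \; m = (m ⊗ diagonal) \; assoc^-1 \; (diagonal ⊗ m^-1).

Definition axM (X : relMagma) : Prop := mulrel X \; (mulrel X)^-1 = diagonal.

Definition axA (X : relMagma) : Prop :=
  let m := mulrel X in
  m \; (diagonal ⊗ m) \; assoc = m \; (m ⊗ diagonal).

Definition is_unit (X : relMagma) (u : set (unit * X)) : Prop :=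
  mulrel X \; (u ⊗ diagonal) \; lunit^-1 = diagonal /\
  mulrel X \; (diagonal ⊗ u) \; runit^-1 = diagonal.
Arguments is_unit : clear implicits.

Definition axU (X : relMagma) : Prop := exists u, is_unit X u.

(* The involution is an arbitrary self-inverse map on the set Rel(1, X): it is
   not assumed to be monotone or to preserve points or unions. *)
Definition axH (X : relMagma) : Prop :=
  let m := mulrel X in
  exists star : set (unit * X) -> set (unit * X),
    involutive star /\
    forall x : set (unit * X),
      m \; (diagonal ⊗ star x) \; runit^-1
        = runit \; (diagonal ⊗ x^-1) \; m^-1 /\
      m \; (star x ⊗ diagonal) \; lunit^-1
        = lunit \; (x^-1 ⊗ diagonal) \; m^-1.

Record frobAlg := FrobAlg {
  frob_magma :> relMagma;
  frobF : axF frob_magma;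
  frobM : axM frob_magma;
  frobA : axA frob_magma;
  frobU : axU frob_magma
}.

Record hstarAlg := HstarAlg {
  hstar_magma :> relMagma;
  hstarM : axM hstar_magma;
  hstarA : axA hstar_magma;
  hstarH : axH hstar_magma
}.

Definition frob_unit (X : frobAlg) : set (unit * X) := sval (cid (frobU X)).
Arguments frob_unit : clear implicits.

(* [pseudoinv f g]: g is a pseudoinverse of f. *)
Definition pseudoinv (X : relMagma) (f g : X) : Prop :=
  (exists2 p, mulrel X ((f, g), p) & mulrel X ((p, f), f)) /\
  (exists2 q, mulrel X ((g, f), q) & mulrel X ((q, g), g)).

Definition condR (X Y : relMagma) (r : set (X * Y)) : Prop :=
  r = [set p | exists x y x' y', [/\ r (x, y), r (x', y'),
                 mulrel X ((x, x'), p.1) & mulrel Y ((y, y'), p.2)]].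
Arguments condR : clear implicits.

Definition condP (X Y : relMagma) (r : set (X * Y)) : Prop :=
  r \; mulrel X = mulrel Y \; (r ⊗ r).
Arguments condP : clear implicits.

Definition condI (X Y : frobAlg) (r : set (X * Y)) : Prop :=
  runit \; (r ⊗ (eta X)^-1) \; assoc \; ((mulrel X)^-1 ⊗ diagonal)
    \; (frob_unit X ⊗ diagonal) \; lunit^-1
  = lunit \; ((frob_unit Y)^-1 ⊗ diagonal) \; (mulrel Y ⊗ diagonal) \; assoc^-1
    \; (r ⊗ eta Y) \; runit^-1.
Arguments condI : clear implicits.

Definition condI' (X Y : hstarAlg) (r : set (X * Y)) : Prop :=
  forall (x x' : X) (y y' : Y),
    pseudoinv x x' -> pseudoinv y y' -> (r (x, y) <-> r (x', y')).
Arguments condI' : clear implicits.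

(* Objects with underlying sets, and morphisms singled out among the relations
   between these; identities and composition are those of Rel. Closure under
   them is the separate predicate [is_category], because the morphisms defined
   by [condR] are not closed under composition: for the group X = Z/2 x Z/2,
   the discrete groupoid Y = {1, 2}, the trivial group 1, and two distinct
   subgroups H_1, H_2 of X of order two, {(x, i) | x in H_i} and Y x 1 satisfy [condR],
   but their composite (H_1 U H_2) x 1 does not. *)
Record relCat := RelCat {
  ob : Type;
  under : ob -> Type;
  hom : forall A B : ob, set (set (under A * under B))
}.
Arguments hom {_} A B.

Definition has_identities (C : relCat) : Prop := forall A : ob C, hom A A diagonal.

Definition is_category (C : relCat) : Prop :=
  has_identities C /\
  forall (A B D : ob C) (r : set (under A * under B)) (s : set (under B * under D)),
    hom A B r -> hom B D s -> hom A D (s \; r).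

(* [fmor] is total for convenience: only its values on morphisms, and on
   composites of morphisms when [is_category C] fails, are constrained. *)
Record relFunctor (C D : relCat) := RelFunctor {
  fobj :> ob C -> ob D;
  fmor : forall A B : ob C,
    set (under A * under B) -> set (under (fobj A) * under (fobj B));
  fmor_hom : forall (A B : ob C) (r : set (under A * under B)),
    hom A B r -> hom (fobj A) (fobj B) (fmor r);
  fmor_id : forall A : ob C, fmor (diagonal : set (under A * under A)) = diagonal;
  fmor_comp : forall (A B E : ob C)
      (r : set (under A * under B)) (s : set (under B * under E)),
    hom A B r -> hom B E s -> fmor (s \; r) = fmor s \; fmor r
}.
Arguments fmor {C D} F {A B} : rename.

(* L is left adjoint to R, in the form: a natural transformation 1 -> R L for
   which f |-> R f \; unit is a bijection of the morphisms L A -> B onto the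
   morphisms A -> R B. This form only composes relations, so it makes sense
   when [is_category] fails. *)
Definition adjoint (C D : relCat) (L : relFunctor C D) (R : relFunctor D C) : Prop :=
  exists unitLR : forall A : ob C, set (under A * under (R (L A))),
    [/\ forall A, hom A (R (L A)) (unitLR A),
        forall (A A' : ob C) (r : set (under A * under A')), hom A A' r ->
          unitLR A' \; r = fmor R (fmor L r) \; unitLR A &
        forall (A : ob C) (B : ob D),
          set_bij (hom (L A) B) (hom A (R B))
            (fun f : set (under (L A) * under B) => fmor R f \; unitLR A)].

Definition FrobRel : relCat :=
  @RelCat frobAlg (fun X => X) (fun X Y => [set r | condR X Y r /\ condI X Y r]).

Definition Frob : relCat :=
  @RelCat frobAlg (fun X => X)
    (fun X Y => [set r : set (X * Y) | condP X Y r /\ condI X Y r]).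

Definition FrobFunc : relCat :=
  @RelCat frobAlg (fun X => X)
    (fun X Y => [set r : set (X * Y) | [/\ condP X Y r, condI X Y r, has_right_adjoint r &
                   r \; frob_unit X `<=` frob_unit Y]]).

Definition HstarRel : relCat :=
  @RelCat hstarAlg (fun X => X)
    (fun X Y => [set r : set (X * Y) | condR X Y r /\ condI' X Y r]).

Definition Hstar : relCat :=
  @RelCat hstarAlg (fun X => X)
    (fun X Y => [set r : set (X * Y) | condP X Y r /\ condI' X Y r]).

Definition HstarFunc : relCat :=
  @RelCat hstarAlg (fun X => X)
    (fun X Y => [set r : set (X * Y) |
                   [/\ condP X Y r, condI' X Y r & has_right_adjoint r]]).

Definition idem_step (X : relMagma) (f g : X) : Prop :=
  [/\ mulrel X ((f, f), f), mulrel X ((g, g), g) & exists h, mulrel X ((g, f), h)].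

Definition idem_eq (X : relMagma) : X -> X -> Prop :=
  clos_refl_sym_trans X (@idem_step X).

Definition quot_set (X : relMagma) : Type :=
  {c : set X | exists x, c = [set y | idem_eq x y]}.

Definition class_of (X : relMagma) (x : X) : quot_set X :=
  exist _ [set y | idem_eq x y] (ex_intro _ x erefl).

(* The multiplication relates [g], [f] to [h] when some representatives g of the
   first and f of the second class have product in the class of h. *)
Definition quot_magma (X : relMagma) : relMagma :=
  @RelMagma (quot_set X)
    [set ((class_of p.1.1, class_of p.1.2), class_of p.2) | p in mulrel X].

(* Main.v *)
Require Import Defs.
From mathcomp Require Import all_boot.
From mathcomp Require Import boolp classical_sets functions.
From Stdlib Require Import Relation_Operators.

Set Implicit Arguments.
Unset Strict Implicit.
Unset Printing Implicit Defensive.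

Local Open Scope classical_set_scope.
Local Open Scope relation_scope.

(** Both kinds of algebra are the same thing, namely groupoids: a groupoid is a
    partial semigroup in which every element has a pseudoinverse and every
    idempotent is an identity wherever it can be multiplied ([groupoid_laws]).

    For a relative Frobenius algebra ([frob_groupoid]), the Frobenius law applied
    to [e f = f s], with units [e] and [s], produces an inverse of [f], and then
    each idempotent is one of the units. For a relative H*-algebra
    ([hstar_groupoid]), axiom (H) on one-point sets makes every element regular,
    because every element is a product; the delicate point is that an
    idempotent acts as an identity ([daggered_idr]). Conversely, a groupoid
    satisfies all the axioms, with the set of identities as unit and elementwise
    inversion as involution. In a groupoid, pseudoinverses are unique and
    (I) and (I') say the same thing ([condI_respects_pseudoinv]): [r] relates
    [x] to [y] iff it relates [x^-1] to [y^-1]. So each Frobenius category has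
    the same morphisms as its H*-counterpart; in the functional case the
    inclusion of units is automatic, as a multiplicative function preserves
    idempotents ([condP_preserves_units]).

    In a groupoid two composable idempotents are equal, so [~] is equality and
    the class map [X -> X/~] is an isomorphism of magmas. Therefore the quotient
    functor, which transports relations along the class maps, is inverse up to
    isomorphism to the functor that keeps the magma and the morphisms. The class
    maps are the unit of the adjunction, and postcomposing with the class map
    of [B] is a bijection on the morphisms into [B]. The argument is carried
    out once ([quot_adjunction]) for any condition on relations that is stable
    under isomorphism and holds for identities. It never requires a
    composite of morphisms to be a morphism, so it also covers (R), which
    composition does not preserve. *)

(** * Pointwise forms of the relational axioms *)

Local Notation mul X x y z := (mulrel X ((x, y), z)).

Ltac rel_destruct :=
  repeat match goal with
  | H : ex2 _ _ |- _ => destruct H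
  | H : ex _ |- _ => destruct H
  | H : _ /\ _ |- _ => destruct H
  | x : (_ * _)%type |- _ => destruct x
  | x : unit |- _ => destruct x
  | H : (_, _) = (_, _) |- _ => case: H => *
  | _ => progress (unfold tens, graph, assoc, lunit, runit, eta, diagonal, mkset in *;
      simpl in * )
  | _ => progress subst
  end.

(* An existential over a product is opened into components, so that the
   projections of its witness compute during unification. *)
Ltac rel_construct :=
  unfold tens, graph, assoc, lunit, runit, eta, diagonal, mkset; simpl;
  repeat match goal with
  | |- @ex2 (unit * (_ * _)) _ _ => refine (ex_intro2 _ _ (tt, (_, _)) _ _) => /=
  | |- @ex2 (unit * _) _ _ => refine (ex_intro2 _ _ (tt, _) _ _) => /=
  | |- @ex2 (_ * unit) _ _ => refine (ex_intro2 _ _ (_, tt) _ _) => /=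
  | |- @ex2 ((_ * _) * _) _ _ => refine (ex_intro2 _ _ ((_, _), _) _ _) => /=
  | |- @ex2 (_ * (_ * _)) _ _ => refine (ex_intro2 _ _ (_, (_, _)) _ _) => /=
  | |- @ex2 (_ * _) _ _ => refine (ex_intro2 _ _ (_, _) _ _) => /=
  | |- ex2 _ _ => esplit => /=
  | |- ex _ => esplit => /=
  | |- _ /\ _ => split => /=
  end; try reflexivity; try eassumption; try reflexivity.

Ltac rel_pointwise := split => *; rel_destruct; rel_construct.

Lemma set_eqP (T : Type) (A B : set T) : A = B <-> forall p, A p <-> B p.
Proof. by split=> [->|AB] //; apply/predeqP. Qed.

Lemma axM_pointwise (X : relMagma) :
  axM X <-> (forall x y z z' : X, mul X x y z -> mul X x y z' -> z = z') /\
            (forall z : X, exists x y, mul X x y z).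
Proof.
rewrite /axM set_eqP; split=> [M|[func surj] [z z']].
  split=> [x y z z' mz mz'|z]; first by apply: (M (z, z')).1; exists (x, y).
  by have [[x y] mz _] := (M (z, z)).2 erefl; exists x, y.
split=> [[[x y] /=]|]; first exact: func.
by rewrite /diagonal /= => <-; have [x [y mz]] := surj z; exists (x, y).
Qed.

Lemma axA_pointwise (X : relMagma) :
  axA X <-> forall x y z w : X,
    (exists2 v, mul X y z v & mul X x v w) <->
    (exists2 u, mul X x y u & mul X u z w).
Proof.
have L x y z w : (mulrel X \; (diagonal ⊗ mulrel X) \; assoc) (((x, y), z), w)
    <-> exists2 v, mul X y z v & mul X x v w by rel_pointwise.
have R x y z w : (mulrel X \; (mulrel X ⊗ diagonal)) (((x, y), z), w)
    <-> exists2 u, mul X x y u & mul X u z w by rel_pointwise.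
rewrite /axA set_eqP; split=> [A x y z w|A [[[x y] z] w]].
  by rewrite -L -R; apply: A.
by rewrite L R; apply: A.
Qed.

Lemma axF_pointwise (X : relMagma) :
  axF X <-> forall a b c e : X,
    ((exists2 d, mul X c d a & mul X d b e) <->
     (exists2 w, mul X a b w & mul X c e w)) /\
    ((exists2 w, mul X a b w & mul X c e w) <->
     (exists2 d, mul X a d c & mul X d e b)).
Proof.
pose m := mulrel X.
have L a b c e : ((diagonal ⊗ m) \; assoc \; (m^-1 ⊗ diagonal)) ((a, b), (c, e))
    <-> exists2 d, mul X c d a & mul X d b e by rel_pointwise.
have C a b c e : (m^-1 \; m) ((a, b), (c, e))
    <-> exists2 w, mul X a b w & mul X c e w by rel_pointwise.
have R a b c e :
    ((m ⊗ diagonal) \; assoc^-1 \; (diagonal ⊗ m^-1)) ((a, b), (c, e))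
    <-> exists2 d, mul X a d c & mul X d e b by rel_pointwise.
rewrite /axF !set_eqP -/m; split=> [[F1 F2] a b c e|F].
  by rewrite -L -C -R; split; [apply: F1|apply: F2].
by split=> -[[a b] [c e]]; rewrite ?L ?C ?R; case: (F a b c e).
Qed.

Lemma mul_left_setE (X : relMagma) (u : set (unit * X)) (x y : X) :
  (mulrel X \; (u ⊗ diagonal) \; lunit^-1) (x, y) <->
  exists2 e, u (tt, e) & mul X e x y.
Proof. by rel_pointwise. Qed.

Lemma mul_right_setE (X : relMagma) (u : set (unit * X)) (x y : X) :
  (mulrel X \; (diagonal ⊗ u) \; runit^-1) (x, y) <->
  exists2 e, u (tt, e) & mul X x e y.
Proof. by rel_pointwise. Qed.

Lemma is_unit_pointwise (X : relMagma) (u : set (unit * X)) :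
  is_unit X u <-> forall x y : X,
    ((exists2 e, u (tt, e) & mul X e x y) <-> x = y) /\
    ((exists2 e, u (tt, e) & mul X x e y) <-> x = y).
Proof.
rewrite /is_unit !set_eqP; split=> [[U1 U2] x y|U].
  by rewrite -mul_left_setE -mul_right_setE; split; [apply: U1|apply: U2].
by split=> -[x y]; rewrite ?mul_left_setE ?mul_right_setE; case: (U x y).
Qed.

Lemma axH_pointwise (X : relMagma) :
  axH X <-> exists2 star : set (unit * X) -> set (unit * X), involutive star &
    forall (x : set (unit * X)) (a f : X),
    ((exists2 c, star x (tt, c) & mul X a c f) <->
     (exists2 b, x (tt, b) & mul X f b a)) /\
    ((exists2 c, star x (tt, c) & mul X c a f) <->
     (exists2 b, x (tt, b) & mul X b f a)).
Proof.
pose m := mulrel X.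
have R x a f : (runit \; (diagonal ⊗ x^-1) \; m^-1) (a, f)
    <-> exists2 b, x (tt, b) & mul X f b a by rel_pointwise.
have L x a f : (lunit \; (x^-1 ⊗ diagonal) \; m^-1) (a, f)
    <-> exists2 b, x (tt, b) & mul X b f a by rel_pointwise.
rewrite /axH; split=> -[star].
  case=> invol H; exists star => // x a f.
  have [/set_eqP H1 /set_eqP H2] := H x.
  rewrite -mul_left_setE -mul_right_setE -R -L.
  by split; [apply: H1|apply: H2].
move=> invol H; exists star; split=> // x.
split; apply/set_eqP=> -[a f]; rewrite ?mul_left_setE ?mul_right_setE ?R ?L;
  by case: (H x a f).
Qed.

Lemma condI_pointwise (X Y : frobAlg) (r : set (X * Y)) :
  condI X Y r <-> forall x y,
    (exists a, r (a, y) /\ exists2 e, frob_unit X (tt, e) & mul X a x e) <->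
    (exists z, r (x, z) /\ exists2 e, frob_unit Y (tt, e) & mul Y z y e).
Proof.
pose lhs := runit \; (r ⊗ (eta X)^-1) \; assoc \; ((mulrel X)^-1 ⊗ diagonal)
    \; (frob_unit X ⊗ diagonal) \; lunit^-1.
pose rhs := lunit \; ((frob_unit Y)^-1 ⊗ diagonal) \; (mulrel Y ⊗ diagonal)
    \; assoc^-1 \; (r ⊗ eta Y) \; runit^-1.
have L x y : lhs (x, y) <->
    exists a, r (a, y) /\ exists2 e, frob_unit X (tt, e) & mul X a x e.
  by rewrite /lhs; rel_pointwise.
have R x y : rhs (x, y) <->
    exists z, r (x, z) /\ exists2 e, frob_unit Y (tt, e) & mul Y z y e.
  by rewrite /rhs; rel_pointwise.
rewrite /condI set_eqP -/lhs -/rhs; split=> [I x y|I [x y]].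
  by rewrite -L -R; apply: I.
by rewrite L R; apply: I.
Qed.

Lemma condP_pointwise (X Y : relMagma) (r : set (X * Y)) :
  condP X Y r <-> forall (x x' : X) (z : Y),
    (exists2 w, mul X x x' w & r (w, z)) <->
    (exists y y', [/\ r (x, y), r (x', y') & mul Y y y' z]).
Proof.
have R x x' z : (mulrel Y \; (r ⊗ r)) ((x, x'), z) <->
    exists y y', [/\ r (x, y), r (x', y') & mul Y y y' z].
  split=> [[[y y'] [/= rxy rxy']]|[y [y' [rxy rxy' mz]]]]; first by exists y, y'.
  by exists (y, y').
rewrite /condP set_eqP; split=> [P x x' z|P [[x x'] z]].
  by rewrite -R; exact: (P ((x, x'), z)).
by rewrite R; exact: (P x x' z).
Qed.

(** * Groupoids *)

Record partial_semigroup (X : relMagma) : Prop := PartialSemigroup {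
  ps_fun : forall x y z z' : X, mul X x y z -> mul X x y z' -> z = z';
  ps_assocL : forall x y z v w : X, mul X y z v -> mul X x v w ->
    exists2 u, mul X x y u & mul X u z w;
  ps_assocR : forall x y z u w : X, mul X x y u -> mul X u z w ->
    exists2 v, mul X y z v & mul X x v w
}.

(** A groupoid without explicit objects: the identities are the idempotents.
    The laws force composability to be the usual one ([gp_composable]), so that
    the set of idempotents plays the role of the set of objects. *)
Record groupoid_laws (X : relMagma) : Prop := GroupoidLaws {
  gp_semigroup :> partial_semigroup X;
  gp_idr : forall x e z : X, mul X e e e -> mul X x e z -> z = x;
  gp_idl : forall e x z : X, mul X e e e -> mul X e x z -> z = x;
  gp_inv : forall x : X, exists x', pseudoinv x x'
}.

Lemma axMA_semigroup (X : relMagma) : axM X -> axA X -> partial_semigroup X.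
Proof.
move=> /axM_pointwise [func _] /axA_pointwise A; split=> //.
- by move=> x y z v w yz xv; apply/A; exists v.
- by move=> x y z u w xy uz; apply/A; exists u.
Qed.

Section PartialSemigroup.
Variables (X : relMagma) (S : partial_semigroup X).

Lemma ps_assocLE (x y z v u w : X) :
  mul X y z v -> mul X x y u -> mul X x v w -> mul X u z w.
Proof.
move=> yz xy xv; have [u' xy' uz] := ps_assocL S yz xv.
by rewrite (ps_fun S xy xy').
Qed.

Lemma ps_assocRE (x y z v u w : X) :
  mul X y z v -> mul X x y u -> mul X u z w -> mul X x v w.
Proof.
move=> yz xy uz; have [v' yz' xv] := ps_assocR S xy uz.
by rewrite (ps_fun S yz yz').
Qed.

(** If [b t b = b] then [t b t] is a pseudoinverse of [b]. *)
Lemma regular_pseudoinv (b t p : X) :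
  mul X b t p -> mul X p b b -> exists b', pseudoinv b b'.
Proof.
move=> bt pb; have [s tb bs] := ps_assocR S bt pb.
have [b' tp b'b] := ps_assocL S pb tb.
have pp : mul X p p p := ps_assocRE bt pb bt.
have bb' : mul X b b' p := ps_assocRE tp bt pp.
have b'p : mul X b' p b' := ps_assocLE pp tp tp.
exists b'; split; first by exists p.
by exists s; [exact: b'b|exact: (ps_assocLE bb' b'b b'p)].
Qed.

Lemma pseudoinv_prod (x x' : X) : pseudoinv x x' -> exists p q : X,
  [/\ mul X x x' p, mul X x' x q, mul X p p p & mul X q q q] /\
  [/\ mul X p x x, mul X x q x, mul X q x' x' & mul X x' p x'].
Proof.
case=> -[p xx' px] [q x'x qx']; exists p, q.
have xq := ps_assocRE x'x xx' px; have x'p := ps_assocRE xx' x'x qx'.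
split; split=> //; first exact: (ps_assocRE xx' px xx').
exact: (ps_assocRE x'x qx' x'x).
Qed.

End PartialSemigroup.

Lemma pseudoinv_sym (X : relMagma) (x y : X) : pseudoinv x y -> pseudoinv y x.
Proof. by case. Qed.

Section Groupoid.
Variables (X : relMagma) (G : groupoid_laws X).

Let assocLE := ps_assocLE G.
Let assocRE := ps_assocRE G.
Let pseudoinv_prod := pseudoinv_prod G.

(** The identity [q = y' y] acts on the right of [x y] and on the left of [z], so
    it is also [z z']; then [(x y) (z z')] is defined, and so is [(x y) z]. *)
Lemma gp_composable (x y z u v : X) :
  mul X x y u -> mul X y z v -> exists w, mul X u z w.
Proof.
move=> xy yz.
have [y' /pseudoinv_prod] := gp_inv G y.
move=> [p [q [[yy' y'y _ qq] [_ yq _ _]]]].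
have [z' /pseudoinv_prod] := gp_inv G z.
move=> [s [_ [[zz' _ ss _] [sz _ _ _]]]].
have [t qz _] := ps_assocR G yq yz.
have [t' qs _] := ps_assocL G sz qz.
have sq : s = q by rewrite -(gp_idl G qq qs) -(gp_idr G ss qs).
have uq := assocLE yq xy xy.
rewrite -sq in uq.
by have [w uz _] := ps_assocL G zz' uq; exists w.
Qed.

Lemma pseudoinv_uniq (x y z : X) : pseudoinv x y -> pseudoinv x z -> y = z.
Proof.
move=> /pseudoinv_prod [p [q [[xy yx pp qq] [px xq qy yp]]]].
move=> /pseudoinv_prod [p' [q' [[xz zx pp' qq'] [px' xq' qz zp']]]].
have [t ppt _] := ps_assocL G px' px.
have ppE : p = p' by rewrite -(gp_idr G pp' ppt) (gp_idl G pp ppt).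
have [t' qqt _] := ps_assocR G xq xq'.
have qqE : q = q' by rewrite -(gp_idr G qq' qqt) (gp_idl G qq qqt).
rewrite -ppE in xz; rewrite -qqE in qz.
exact: (ps_fun G yp (assocRE xz yx qz)).
Qed.

(** A left inverse in a groupoid is two-sided: [a = a (x x') = (a x) x' = x']. *)
Lemma pseudoinvP (a x : X) :
  pseudoinv a x <-> exists2 e, mul X e e e & mul X a x e.
Proof.
split=> [/pseudoinv_prod [p [q [[ax _ pp _] _]]]|[e ee ax]]; first by exists p.
have [x' x'P] := gp_inv G x.
have [p [q [[xx' x'x pp qq] [px xq qx' x'p]]]] := pseudoinv_prod x'P.
have [w ex'] := gp_composable ax xx'.
have ax' := assocRE xx' ax ex'.
suff <- : x' = a by apply: pseudoinv_sym.
by rewrite -(gp_idl G ee ex') (gp_idr G pp ax').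
Qed.

(** Any unit of [X] is the set of identities. *)
Lemma is_unit_idem (u : set (unit * X)) : is_unit X u ->
  forall e, u (tt, e) <-> mul X e e e.
Proof.
move=> /is_unit_pointwise U e; split=> [ue|ee].
  have [e' /pseudoinv_prod [p [q [[_ _ _ qq] [_ eq _ _]]]]] := gp_inv G e.
  suff qe : q = e by rewrite qe in qq.
  by apply/(U q e).1; exists e.
have [d ud de] := (U e e).1.2 erefl.
suff -> : e = d by [].
by rewrite -(gp_idr G ee de).
Qed.

Lemma groupoid_axM : axM X.
Proof.
apply/axM_pointwise; split; first exact: (ps_fun G).
move=> z; have [z' /pseudoinv_prod [p [q [_ [pz _ _ _]]]]] := gp_inv G z.
by exists p, z.
Qed.

Lemma groupoid_axA : axA X.
Proof.
apply/axA_pointwise => x y z w; split=> -[t].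
  exact: (ps_assocL G).
exact: (ps_assocR G).
Qed.

Lemma groupoid_axU : axU X.
Proof.
exists [set p | mul X p.2 p.2 p.2]; apply/is_unit_pointwise => x y; split; split.
- by move=> [e /= ee] /(gp_idl G ee).
- move=> <-; have [x' /pseudoinv_prod [p [q [[]]]]] := gp_inv G x.
  by move=> _ _ pp _ [px _ _ _]; exists p.
- by move=> [e /= ee] /(gp_idr G ee).
- move=> <-; have [x' /pseudoinv_prod [p [q [[]]]]] := gp_inv G x.
  by move=> _ _ _ qq [_ xq _ _]; exists q.
Qed.

(** Given [a b = c e], the mediating elements are [c^-1 a] and [b e^-1]. *)
Lemma groupoid_axF : axF X.
Proof.
have leftD a b c e w : mul X a b w -> mul X c e w ->
    exists2 d, mul X c d a & mul X d b e.
  move=> ab ce; have [c' /pseudoinv_prod] := gp_inv G c.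
  move=> [p [q [[cc' c'c pp qq] [pc cq _ _]]]].
  have [t qe _] := ps_assocR G cq ce; have tE := gp_idl G qq qe; subst t.
  have c'w := assocRE ce c'c qe.
  have [d c'a db] := ps_assocL G ab c'w.
  exists d => //.
  have [t1 pw] : exists t1, mul X p w t1.
    by exists w; exact: (assocRE ce pc ce).
  have [t2 pa _] := ps_assocL G ab pw; have tE := gp_idl G pp pa; subst t2.
  exact: (assocRE c'a cc' pa).
have rightD a b c e w : mul X a b w -> mul X c e w ->
    exists2 d, mul X a d c & mul X d e b.
  move=> ab ce; have [e' /pseudoinv_prod] := gp_inv G e.
  move=> [p [q [[ee' e'e pp qq] [pe eq _ _]]]].
  have [t cp _] := ps_assocL G pe ce; have tE := gp_idr G pp cp; subst t.
  have we' := assocLE ee' ce cp.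
  have [d be' ad] := ps_assocR G ab we'.
  exists d => //.
  have [t1 wq] : exists t1, mul X w q t1.
    by exists w; exact: (assocLE eq ce ce).
  have [t2 bq _] := ps_assocR G ab wq; have tE := gp_idr G qq bq; subst t2.
  exact: (assocLE e'e be' bq).
apply/axF_pointwise => a b c e; split; split.
- move=> [d cd db]; have [w ab] := gp_composable cd db.
  by exists w => //; exact: (assocRE db cd ab).
- by move=> [w]; apply: leftD.
- by move=> [w]; apply: rightD.
- move=> [d ad de]; have [w ce] := gp_composable ad de.
  by exists w => //; exact: (assocRE de ad ce).
Qed.

(** The involution is elementwise inversion. *)
Lemma groupoid_axH : axH X.
Proof.
pose inverses (x : set (unit * X)) :=
  [set p : unit * X | exists2 b, x (tt, b) & pseudoinv b p.2].
apply/axH_pointwise; exists inverses.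
  move=> x; apply/set_eqP => -[[] b]; split=> [[c [d xd dc] /= cb]|xb].
    by rewrite (pseudoinv_uniq cb (pseudoinv_sym dc)).
  have [c bc] := gp_inv G b.
  by exists c; [exists b|apply: pseudoinv_sym].
have mulr b c a f : pseudoinv b c -> mul X a c f -> mul X f b a.
  move=> /pseudoinv_prod [p [q [[bc cb pp qq] _]]] ac.
  have [w fb] := gp_composable ac cb.
  by have aq := assocRE cb ac fb; rewrite -(gp_idr G qq aq).
have mull b c a f : pseudoinv b c -> mul X c a f -> mul X b f a.
  move=> /pseudoinv_prod [p [q [[bc cb pp qq] _]]] ca.
  have [w pa] := gp_composable bc ca.
  by rewrite -(gp_idl G pp pa); exact: (assocRE ca bc pa).
move=> x a f; split; split=> -[c].
- by move=> [b xb bc] ac; exists b => //; apply: mulr bc ac.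
- move=> xc fc; have [c' cc'] := gp_inv G c.
  by exists c'; [exists c|apply: mulr (pseudoinv_sym cc') fc].
- by move=> [b xb bc] ac; exists b => //; apply: mull bc ac.
- move=> xc fc; have [c' cc'] := gp_inv G c.
  by exists c'; [exists c|apply: mull (pseudoinv_sym cc') fc].
Qed.

(** Two composable idempotents are both equal to their product, since each of
    them acts as an identity on the other. *)
Lemma groupoid_idem_eq (x y : X) : idem_eq x y <-> x = y.
Proof.
split=> [|->]; last exact: rst_refl.
elim=> {x y} [x y [xx yy [h yx]]||x y _ ->|x y z _ -> _ ->] //.
by rewrite -(gp_idl G yy yx) (gp_idr G xx yx).
Qed.

End Groupoid.

(** * Relative Frobenius algebras are groupoids *)

Section FrobeniusGroupoid.
Variable X : frobAlg.

Let S : partial_semigroup X := axMA_semigroup (frobM X) (frobA X).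

Lemma frob_groupoid : groupoid_laws X.
Proof.
have [u /is_unit_pointwise U] := frobU X.
have ul e x y : u (tt, e) -> mul X e x y -> x = y.
  by move=> ue ex; apply/(U x y).1; exists e.
have ur e x y : u (tt, e) -> mul X x e y -> x = y.
  by move=> ue xe; apply/(U x y).2; exists e.
(* The Frobenius law applied to [e f = f s], with units [e] and [s], yields
   the inverse of [f]. *)
have inverse f : exists d e s, [/\ u (tt, e), u (tt, s), mul X f d e,
    mul X d f s & mul X e f f /\ mul X f s f].
  have [e ue ef] := (U f f).1.2 erefl; have [s us fs] := (U f f).2.2 erefl.
  have [F _] := (axF_pointwise X).1 (frobF X) e f f s.
  have [d fd df] : exists2 d, mul X f d e & mul X d f s by apply/F; exists f.
  by exists d, e, s.
have idem_unit f : mul X f f f -> u (tt, f).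
  move=> ff; have [d [e [s [ue us fd df [ef fs]]]]] := inverse f.
  have [t df' sf] := ps_assocL S ff df.
  rewrite (ps_fun S df' df) in sf.
  by rewrite (ul _ _ _ us sf).
split=> //.
- by move=> x e z /idem_unit ue xe; rewrite (ur _ _ _ ue xe).
- by move=> e x z /idem_unit ue ex; rewrite (ul _ _ _ ue ex).
- move=> f; have [d [e [s [ue us fd df [ef fs]]]]] := inverse f.
  exact: (regular_pseudoinv S fd ef).
Qed.

End FrobeniusGroupoid.

(** * Relative H*-algebras are groupoids *)

(** The part of the H*-axiom about one-point sets: [D b c] stands for
    [c \in {b}^*], so that right multiplication by [b] is the converse of
    right multiplication by the elements [D]-related to [b], and likewise on the
    left. *)
Record daggered (X : relMagma) (D : X -> X -> Prop) : Prop := Daggered {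
  dag_semigroup :> partial_semigroup X;
  dag_r : forall b f a : X, mul X f b a -> exists2 c, D b c & mul X a c f;
  dag_rK : forall b c a f : X, D b c -> mul X a c f -> mul X f b a;
  dag_l : forall b f a : X, mul X b f a -> exists2 c, D b c & mul X c a f;
  dag_lK : forall b c a f : X, D b c -> mul X c a f -> mul X b f a
}.

Definition op_magma (X : relMagma) : relMagma :=
  @RelMagma X [set p | mul X p.1.2 p.1.1 p.2].

(** Reversing the multiplication exchanges the two halves of the axiom, so that
    results about one side transfer to the other. *)
Lemma daggered_op (X : relMagma) (D : X -> X -> Prop) :
  daggered D -> @daggered (op_magma X) D.
Proof.
move=> H; split.
- split=> [x y z z'|x y z v w yz xv|x y z u w xy uz]; first exact: (ps_fun H).
    by have [t] := ps_assocR H yz xv; exists t.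
  by have [t] := ps_assocL H xy uz; exists t.
- exact: (dag_l H).
- exact: (dag_lK H).
- exact: (dag_r H).
- exact: (dag_rK H).
Qed.

(** Suppose that [f e = k] with [e] idempotent. Then [k e = k], and
    [f = k c] for some [c] in [{e}^*]. The product [p = e c] is an idempotent
    with [p e = e] and [e p = p]. By the axiom, [p = c1 p] for some [c1] in
    [{e}^*]; then [c1 e = e], and [(p c1) e] is [p] by the axiom but
    [p (c1 e) = p e = e] by associativity. So [p = e], hence
    [f = k c = k p = k e = k]. *)
Lemma daggered_idr (X : relMagma) (D : X -> X -> Prop) : daggered D ->
  forall f e k : X, mul X e e e -> mul X f e k -> k = f.
Proof.
move=> H f e k ee fe.
have ke : mul X k e k := ps_assocLE H ee fe fe.
have [c Dc kc] := dag_r H fe.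
have [p ec kp] := ps_assocR H ke kc.
have [q ce _] := ps_assocR H kc fe.
have pe : mul X p e e := ps_assocLE H ce ec (dag_lK H Dc ce).
have ep : mul X e p p := ps_assocRE H ec ee ec.
have pp : mul X p p p := ps_assocRE H ec pe ec.
have [c1 Dc1 c1p] := dag_l H ep.
have c1e : mul X c1 e e := ps_assocRE H pe c1p pe.
have [z pc1 zp] := ps_assocL H c1p pp.
have zeE : mul X z e e := ps_assocLE H c1e pc1 pe.
have pE : p = e := ps_fun H (dag_rK H Dc1 pc1) zeE.
by rewrite pE in kp; apply: (ps_fun H ke kp).
Qed.

(** Writing [b = g h], the axiom gives [g = b c] and [h = c' b], so that
    [b = b (c c') b] is regular. *)
Lemma daggered_groupoid (X : relMagma) (D : X -> X -> Prop) :
  (forall b : X, exists g h, mul X g h b) -> daggered D -> groupoid_laws X.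
Proof.
move=> surj H; split; first exact: H.
- by move=> x e z ee xe; apply: (daggered_idr H ee xe).
- by move=> e x z ee ex; apply: (daggered_idr (daggered_op H) ee ex).
- move=> b; have [g [h gh]] := surj b.
  have [c _ bc] := dag_r H gh; have [c' _ c'b] := dag_l H gh.
  have [v ch bv] := ps_assocR H bc gh.
  have [t _ tb] := ps_assocL H c'b ch.
  have [p bt pb] := ps_assocL H tb bv.
  exact: (regular_pseudoinv H bt pb).
Qed.

Lemma hstar_groupoid (X : hstarAlg) : groupoid_laws X.
Proof.
have [star _ H] := (axH_pointwise X).1 (hstarH X).
pose pt b : set (unit * X) := [set (tt, b)].
apply: (@daggered_groupoid X (fun b c => star (pt b) (tt, c))).
  by have /axM_pointwise[] := hstarM X.
split; first exact: axMA_semigroup (hstarM X) (hstarA X).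
- by move=> b f a fb; apply/(H (pt b) a f).1; exists b.
- move=> b c a f bc ac.
  by have [_ [<-] //] : exists2 d, pt b (tt, d) & mul X f d a
    by apply/(H (pt b) a f).1; exists c.
- by move=> b f a bf; apply/(H (pt b) a f).2; exists b.
- move=> b c a f bc ca.
  by have [_ [<-] //] : exists2 d, pt b (tt, d) & mul X d f a
    by apply/(H (pt b) a f).2; exists c.
Qed.

(** * Conditions on morphisms *)

(** Condition (I') stated for magmas, so that it makes sense between algebras of
    either kind. *)
Definition respects_pseudoinv (X Y : relMagma) (r : set (X * Y)) : Prop :=
  forall (x x' : X) (y y' : Y),
    pseudoinv x x' -> pseudoinv y y' -> (r (x, y) <-> r (x', y')).

Lemma frob_unit_idem (X : frobAlg) (e : X) :
  frob_unit X (tt, e) <-> mul X e e e.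
Proof.
exact: (is_unit_idem (frob_groupoid X) (svalP (cid (frobU X)))).
Qed.

(** Evaluated at [(x, y)], the left side of (I) is [r (x^-1, y)] and the right
    side is [r (x, y^-1)]. *)
Lemma condI_respects_pseudoinv (X Y : frobAlg) (r : set (X * Y)) :
  condI X Y r <-> respects_pseudoinv r.
Proof.
have GX := frob_groupoid X; have GY := frob_groupoid Y.
have unitP (Z : frobAlg) (a x : Z) :
    (exists2 e, frob_unit Z (tt, e) & mul Z a x e) <-> pseudoinv a x.
  rewrite (pseudoinvP (frob_groupoid Z)).
  by split=> -[e ee ax]; exists e => //; apply/frob_unit_idem.
split=> [/condI_pointwise I|I].
  have half x x' y y' : pseudoinv x x' -> pseudoinv y y' ->
      r (x, y) -> r (x', y').
    move=> xx' yy' rxy.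
    have [|z [rz /unitP zy]] := (I x' y).1.
      by exists x; split=> //; apply/unitP.
    by rewrite (pseudoinv_uniq GY yy' (pseudoinv_sym zy)).
  move=> x x' y y' xx' yy'; split; first exact: half.
  by apply: half; apply: pseudoinv_sym.
apply/condI_pointwise => x y; split=> -[a [ra /unitP ax]].
  have [y' yy'] := gp_inv GY y; exists y'.
  by split; [apply/(I _ _ _ _ ax yy')|apply/unitP/pseudoinv_sym].
have [x' xx'] := gp_inv GX x; exists x'.
by split; [apply/(I _ _ _ _ xx' ax)|apply/unitP/pseudoinv_sym].
Qed.

Lemma respects_pseudoinv_diagonal (X : relMagma) : groupoid_laws X ->
  respects_pseudoinv (diagonal : set (X * X)).
Proof.
move=> G x x' y y' xx' yy'; rewrite /diagonal /=; split=> E; subst.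
  exact: (pseudoinv_uniq G xx' yy').
exact: (pseudoinv_uniq G (pseudoinv_sym xx') (pseudoinv_sym yy')).
Qed.

Lemma respects_pseudoinv_comp (X Y Z : relMagma)
    (r : set (X * Y)) (s : set (Y * Z)) : groupoid_laws Y ->
  respects_pseudoinv r -> respects_pseudoinv s -> respects_pseudoinv (s \; r).
Proof.
move=> G Ir Is x x' z z' xx' zz'.
split=> -[y /= rxy syz]; have [y' yy'] := gp_inv G y; exists y' => /=.
- by apply/(Ir _ _ _ _ xx' yy').
- by apply/(Is _ _ _ _ yy' zz').
- by apply/(Ir _ _ _ _ xx' (pseudoinv_sym yy')).
- by apply/(Is _ _ _ _ (pseudoinv_sym yy') zz').
Qed.

Lemma condP_diagonal (X : relMagma) : condP X X diagonal.
Proof.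
apply/condP_pointwise => x x' z; rewrite /diagonal /=; split.
  by move=> [w xx' <-]; exists x, x'.
by move=> [y [y' [-> -> yy']]]; exists z.
Qed.

Lemma condP_comp (X Y Z : relMagma) (r : set (X * Y)) (s : set (Y * Z)) :
  condP X Y r -> condP Y Z s -> condP X Z (s \; r).
Proof.
move=> /condP_pointwise Pr /condP_pointwise Ps.
apply/condP_pointwise => x x' z; split.
  move=> [w xx' [y /= rwy syz]].
  have [y1 [y2 [r1 r2 yy]]] := (Pr x x' y).1 (ex_intro2 _ _ w xx' rwy).
  have [z1 [z2 [s1 s2 zz]]] := (Ps y1 y2 z).1 (ex_intro2 _ _ y yy syz).
  by exists z1, z2; split=> //; [exists y1|exists y2].
move=> [z1 [z2 [[y1 /= r1 s1] [y2 /= r2 s2] zz]]].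
have [y yy syz] := (Ps y1 y2 z).2 (ex_intro _ z1 (ex_intro _ z2 (And3 s1 s2 zz))).
have [w xx' rwy] := (Pr x x' y).2 (ex_intro _ y1 (ex_intro _ y2 (And3 r1 r2 yy))).
by exists w => //; exists y.
Qed.

Lemma condR_diagonal (X : relMagma) : axM X -> condR X X diagonal.
Proof.
move=> /axM_pointwise [func surj]; apply/set_eqP => -[z z'].
rewrite /diagonal /=; split.
  by move=> <-; have [x [x' xx']] := surj z; exists x, x, x', x'.
by move=> [x [_ [x' [_ [<- <- + +]]]]]; apply: func.
Qed.

Lemma has_right_adjointP (X Y : Type) (r : set (X * Y)) :
  has_right_adjoint r <->
  (forall x, exists y, r (x, y)) /\
  (forall x y y', r (x, y) -> r (x, y') -> y = y').
Proof.
split=> [[s [total single]]|[total single]].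
  have total' x : exists2 y, r (x, y) & s (y, x) by exact: (total (x, x)).
  split=> [x|x y y' ry ry']; first by have [y] := total' x; exists y.
  have [z rz sz] := total' x.
  have E w : r (x, w) -> z = w by move=> rw; apply: (single (z, w)); exists x.
  by rewrite -(E y) // -(E y').
exists (r^-1); split=> [[x x'] E|[y y'] [x /= ry ry']].
  by have [y ry] := total x; exists y; rewrite /= -?(E : x = x').
exact: single ry ry'.
Qed.

Lemma has_right_adjoint_diagonal (X : Type) :
  has_right_adjoint (diagonal : set (X * X)).
Proof.
apply/has_right_adjointP; split=> [x|x y y' xy xy']; first by exists x.
by rewrite -(xy : x = y) -(xy' : x = y').
Qed.

Lemma has_right_adjoint_comp (X Y Z : Type) (r : set (X * Y)) (s : set (Y * Z)) :
  has_right_adjoint r -> has_right_adjoint s -> has_right_adjoint (s \; r).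
Proof.
move=> /has_right_adjointP [tr sr] /has_right_adjointP [ts ss].
apply/has_right_adjointP; split=> [x|x z z' [y /= ry sy] [y' /= ry' sy']].
  by have [y ry] := tr x; have [z sz] := ts y; exists z, y.
by apply: ss sy _; rewrite (sr _ _ _ ry ry').
Qed.

(** Units are idempotents, and a multiplicative function sends idempotents to
    idempotents. *)
Lemma condP_preserves_units (X Y : frobAlg) (r : set (X * Y)) :
  condP X Y r -> has_right_adjoint r -> r \; frob_unit X `<=` frob_unit Y.
Proof.
move=> /condP_pointwise P /has_right_adjointP [_ single].
move=> [[] y] [e /= /frob_unit_idem ee rey]; apply/frob_unit_idem.
have [y1 [y2 [r1 r2 yy]]] := (P e e y).1 (ex_intro2 _ _ e ee rey).
by rewrite (single _ _ _ r1 rey) (single _ _ _ r2 rey) in yy.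
Qed.

(** * Transport along isomorphisms *)

Definition magma_iso (X Y : relMagma) (g : X -> Y) : Prop :=
  bijective g /\ forall a b c : X, mul X a b c <-> mul Y (g a) (g b) (g c).

Definition pull (X X' Y Y' : Type) (g : X' -> X) (h : Y' -> Y)
    (r : set (X * Y)) : set (X' * Y') := [set p | r (g p.1, h p.2)].

Definition iso_invariant (K : forall X Y : relMagma, set (set (X * Y))) : Prop :=
  forall (X X' Y Y' : relMagma) (g : X' -> X) (h : Y' -> Y) (r : set (X * Y)),
  magma_iso g -> magma_iso h -> K X Y r -> K X' Y' (pull g h r).

Lemma magma_iso_id (X : relMagma) : magma_iso (@id X).
Proof. by split=> //; exists id. Qed.

Lemma magma_iso_surj (X Y : relMagma) (g : X -> Y) (y : Y) :
  magma_iso g -> exists x, g x = y.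
Proof. by move=> [[f gK fK] _]; exists (f y). Qed.

Lemma magma_iso_inv (X Y : relMagma) (g : X -> Y) (f : Y -> X) :
  cancel f g -> magma_iso g -> magma_iso f.
Proof.
move=> fK [bij mulE]; have gK : cancel g f by apply/(bij_can_sym bij).
by split=> [|a b c]; [exists g|rewrite mulE !fK].
Qed.

Lemma pseudoinv_iso (X Y : relMagma) (g : X -> Y) (x x' : X) : magma_iso g ->
  pseudoinv x x' <-> pseudoinv (g x) (g x').
Proof.
move=> giso; have mulE := giso.2.
split=> -[[p xx' px] [q x'x qx']].
  by split; [exists (g p)|exists (g q)]; rewrite -?mulE.
have [p' p'E] := magma_iso_surj p giso; have [q' q'E] := magma_iso_surj q giso.
by subst; split; [exists p'|exists q']; rewrite ?mulE.
Qed.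

Lemma groupoid_iso (X Y : relMagma) (g : X -> Y) :
  magma_iso g -> groupoid_laws Y -> groupoid_laws X.
Proof.
move=> giso G; have [/bij_inj ginj mulE] := giso.
have surj y := magma_iso_surj y giso.
split; first split.
- by move=> x y z z' /mulE m1 /mulE m2; apply/ginj/(ps_fun G m1 m2).
- move=> x y z v w /mulE yz /mulE xv.
  have [u xy uz] := ps_assocL G yz xv; have [u' uE] := surj u.
  by subst; exists u'; apply/mulE.
- move=> x y z u w /mulE xy /mulE uz.
  have [v yz xv] := ps_assocR G xy uz; have [v' vE] := surj v.
  by subst; exists v'; apply/mulE.
- by move=> x e z /mulE ee /mulE xe; apply/ginj/(gp_idr G ee xe).
- by move=> e x z /mulE ee /mulE ex; apply/ginj/(gp_idl G ee ex).
- move=> x; have [y xy] := gp_inv G (g x); have [x' yE] := surj y.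
  by subst; exists x'; apply/(pseudoinv_iso _ _ giso).
Qed.

Lemma respects_pseudoinv_iso : iso_invariant respects_pseudoinv.
Proof.
move=> X X' Y Y' g h r giso hiso I x x' y y'.
by move=> /(pseudoinv_iso _ _ giso) xx' /(pseudoinv_iso _ _ hiso); apply: I.
Qed.

Lemma condP_iso : iso_invariant condP.
Proof.
move=> X X' Y Y' g h r giso hiso /condP_pointwise P.
have surjX x := magma_iso_surj x giso; have surjY y := magma_iso_surj y hiso.
apply/condP_pointwise => x x' z; rewrite /pull /=; split.
  move=> [w /giso.2 xx' rwz].
  have [y1 [y2 [r1 r2 yy]]] :=
    (P (g x) (g x') (h z)).1 (ex_intro2 _ _ (g w) xx' rwz).
  have [y1' E1] := surjY y1; have [y2' E2] := surjY y2; subst.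
  by exists y1', y2'; split=> //; apply/hiso.2.
move=> [y1 [y2 [r1 r2 /hiso.2 yy]]].
have [w xx' rwz] :=
  (P (g x) (g x') (h z)).2 (ex_intro _ _ (ex_intro _ _ (And3 r1 r2 yy))).
have [w' wE] := surjX w; subst.
by exists w' => //; apply/giso.2.
Qed.

Lemma condR_iso : iso_invariant condR.
Proof.
move=> X X' Y Y' g h r giso hiso /set_eqP R.
have surjX x := magma_iso_surj x giso; have surjY y := magma_iso_surj y hiso.
apply/set_eqP => -[w z]; rewrite /pull /=; split.
  move=> /R [x [y [x' [y' [rxy rxy' /= xx' yy']]]]].
  have [? ?] := surjX x; have [? ?] := surjX x'.
  have [? ?] := surjY y; have [? ?] := surjY y'; subst.
  by do 4!eexists; split; [exact: rxy|exact: rxy'|apply/giso.2|apply/hiso.2].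
move=> [x [y [x' [y' [rxy rxy' /giso.2 xx' /hiso.2 yy']]]]].
by apply/R; exists (g x), (h y), (g x'), (h y').
Qed.

Lemma has_right_adjoint_iso :
  iso_invariant (fun X Y r => has_right_adjoint r).
Proof.
move=> X X' Y Y' g h r _ hiso /has_right_adjointP [total single].
apply/has_right_adjointP; split=> [x|x y y' ry ry'].
  have [y ry] := total (g x); have [y' yE] := magma_iso_surj y hiso.
  by exists y'; rewrite /pull /= yE.
by apply: (bij_inj hiso.1); apply: single ry ry'.
Qed.

(** * The quotient by composable idempotents *)

Definition repr (X : relMagma) (c : quot_set X) : X := sval (cid (svalP c)).
Arguments repr : clear implicits.

Lemma class_of_repr (X : relMagma) (c : quot_set X) : class_of (repr X c) = c.
Proof.
rewrite /repr; case: (cid (svalP c)) => x /=; case: c => c cP /= E.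
by subst c; congr exist; apply: Prop_irrelevance.
Qed.

Section Quotient.
Variables (X : relMagma) (G : groupoid_laws X).

Lemma repr_class_of (x : X) : repr X (class_of x) = x.
Proof.
have /(congr1 sval) /= /set_eqP /(_ x) E := class_of_repr (class_of x).
apply/(groupoid_idem_eq G)/E; exact: rst_refl.
Qed.

Lemma quot_mulE (a b c : quot_magma X) :
  mul (quot_magma X) a b c <-> mul X (repr X a) (repr X b) (repr X c).
Proof.
split=> [[[[x y] z] /= xy [<- <- <-]]|abc]; first by rewrite !repr_class_of.
by exists ((repr X a, repr X b), repr X c); rewrite //= !class_of_repr.
Qed.

Lemma repr_iso : @magma_iso (quot_magma X) X (repr X).
Proof.
split; last exact: quot_mulE.
by exists (@class_of X); [exact: class_of_repr|exact: repr_class_of].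
Qed.

Lemma class_of_iso : @magma_iso X (quot_magma X) (@class_of X).
Proof. exact: magma_iso_inv repr_class_of repr_iso. Qed.

Lemma quot_groupoid : groupoid_laws (quot_magma X).
Proof. exact: groupoid_iso repr_iso G. Qed.

End Quotient.

Definition frob_of_groupoid (X : relMagma) (G : groupoid_laws X) : frobAlg :=
  FrobAlg (groupoid_axF G) (groupoid_axM G) (groupoid_axA G) (groupoid_axU G).

Definition hstar_of_groupoid (X : relMagma) (G : groupoid_laws X) : hstarAlg :=
  HstarAlg (groupoid_axM G) (groupoid_axA G) (groupoid_axH G).

(** * The adjunctions *)

Section Adjunction.

(** Each of the three pairs of categories comes from one condition [K] on
    relations between magmas, because (I) and (I') agree. *)
Variable K : forall X Y : relMagma, set (set (X * Y)).
Arguments K : clear implicits.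
Hypothesis K_id : forall X, groupoid_laws X -> K X X diagonal.
Hypothesis K_iso : iso_invariant K.

Definition frob_cat : relCat := @RelCat frobAlg id (fun X Y => K X Y).
Definition hstar_cat : relCat := @RelCat hstarAlg id (fun X Y => K X Y).

Lemma frob_cat_id : has_identities frob_cat.
Proof. by move=> X; apply/K_id/frob_groupoid. Qed.

Lemma hstar_cat_id : has_identities hstar_cat.
Proof. by move=> X; apply/K_id/hstar_groupoid. Qed.

Definition comp_closed : Prop :=
  forall (X Y Z : relMagma) (r : set (X * Y)) (s : set (Y * Z)),
  groupoid_laws Y -> K X Y r -> K Y Z s -> K X Z (s \; r).

Lemma frob_catP : comp_closed -> is_category frob_cat.
Proof.
move=> K_comp; split; first exact: frob_cat_id.
by move=> X Y Z r s; apply: K_comp (frob_groupoid Y).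
Qed.

Lemma hstar_catP : comp_closed -> is_category hstar_cat.
Proof.
move=> K_comp; split; first exact: hstar_cat_id.
by move=> X Y Z r s; apply: K_comp (hstar_groupoid Y).
Qed.

Definition to_hstar : relFunctor frob_cat hstar_cat.
Proof.
exact: (@RelFunctor frob_cat hstar_cat
  (fun X => hstar_of_groupoid (frob_groupoid X)) (fun X Y r => r)).
Defined.

Definition quot_functor : relFunctor hstar_cat frob_cat.
Proof.
apply: (@RelFunctor hstar_cat frob_cat
  (fun X => frob_of_groupoid (quot_groupoid (hstar_groupoid X)))
  (fun X Y => pull (repr X) (repr Y))).
- move=> X Y r; apply: K_iso; exact: repr_iso (hstar_groupoid _).
- move=> X; apply/set_eqP => -[a b]; rewrite /pull /diagonal /=; split=> [ab|->//].
  by rewrite -(class_of_repr a) ab class_of_repr.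
- move=> X Y Z r s _ _; apply/set_eqP => -[a c]; split=> -[b rb sb].
    exists (class_of b); by rewrite /pull /= (repr_class_of (hstar_groupoid Y)).
  by exists (repr Y b).
Defined.

(** The unit at [X] is the graph of the class map; it is written as a pullback of
    the identity relation along representatives, because [K] is known to be
    stable under pullbacks. For the same reason the inverse of the bijection
    pulls back along the class map of [B]. *)
Lemma quot_adjunction : adjoint to_hstar quot_functor.
Proof.
have projE (X B : relMagma) (G : groupoid_laws X) (f : set (X * B)) :
    pull (repr X) (repr B) f \; pull id (repr X) diagonal = pull id (repr B) f.
  apply/set_eqP => -[x b]; rewrite /pull /diagonal /=; split=> [[c /= -> //]|fxb].
  by exists (class_of x); rewrite /= (repr_class_of G).
exists (fun X : frobAlg => pull id (repr X) diagonal); split.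
- move=> X; have G := frob_groupoid X.
  exact: (K_iso (magma_iso_id X) (repr_iso G) (K_id G)).
- move=> X Y r _; rewrite /= (projE _ _ (frob_groupoid X)).
  apply/set_eqP => -[x c]; rewrite /pull /diagonal /=.
  by split=> [[y /= rxy <-]//|rxc]; exists (repr Y c).
- move=> X B; have G := hstar_groupoid B; split.
  + move=> f Kf; rewrite /= (projE _ _ (frob_groupoid X)).
    exact: (K_iso (magma_iso_id X) (repr_iso G) Kf).
  + move=> f g _ _; rewrite /= !(projE _ _ (frob_groupoid X)) => /set_eqP E.
    apply/set_eqP => -[x b]; have := E (x, class_of b).
    by rewrite /pull /= (repr_class_of G).
  + move=> h Kh; exists (pull id (@class_of B) h).
      exact: (K_iso (magma_iso_id X) (class_of_iso G) Kh).
    rewrite /= (projE _ _ (frob_groupoid X)); apply/set_eqP => -[x c].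
    by rewrite /pull /= class_of_repr.
Qed.

Lemma quot_adjunction_exists :
  exists (L : relFunctor frob_cat hstar_cat) (R : relFunctor hstar_cat frob_cat),
    adjoint L R /\ forall B : hstarAlg, frob_magma (R B) = quot_magma B.
Proof. by exists to_hstar, quot_functor; split=> //; apply: quot_adjunction. Qed.

End Adjunction.

Definition rel_condition (X Y : relMagma) : set (set (X * Y)) :=
  [set r | condR X Y r /\ respects_pseudoinv r].

Definition mor_condition (X Y : relMagma) : set (set (X * Y)) :=
  [set r | condP X Y r /\ respects_pseudoinv r].

Definition func_condition (X Y : relMagma) : set (set (X * Y)) :=
  [set r | [/\ condP X Y r, respects_pseudoinv r & has_right_adjoint r]].

Arguments rel_condition : clear implicits.
Arguments mor_condition : clear implicits.
Arguments func_condition : clear implicits.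

Lemma FrobRel_homE :
  @hom FrobRel = (fun X Y => rel_condition X Y)
    :> forall X Y : frobAlg, set (set (X * Y)).
Proof.
do 2![apply: functional_extensionality_dep => ?].
by apply/set_eqP => r; split=> -[Rr /condI_respects_pseudoinv Ir].
Qed.

Lemma Frob_homE :
  @hom Frob = (fun X Y => mor_condition X Y)
    :> forall X Y : frobAlg, set (set (X * Y)).
Proof.
do 2![apply: functional_extensionality_dep => ?].
by apply/set_eqP => r; split=> -[Pr /condI_respects_pseudoinv Ir].
Qed.

Lemma FrobFunc_homE :
  @hom FrobFunc = (fun X Y => func_condition X Y)
    :> forall X Y : frobAlg, set (set (X * Y)).
Proof.
do 2![apply: functional_extensionality_dep => ?].
apply/set_eqP => r; split=> [[Pr /condI_respects_pseudoinv Ir Ar _]|] //.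
move=> [Pr /condI_respects_pseudoinv Ir Ar]; split=> //.
exact: condP_preserves_units.
Qed.

Theorem corollary42 :
  (* functional case *)
  (is_category FrobFunc /\ is_category HstarFunc /\
   exists (L : relFunctor FrobFunc HstarFunc) (R : relFunctor HstarFunc FrobFunc),
     adjoint L R /\
     forall B : hstarAlg, frob_magma (R B) = quot_magma B) /\
  (is_category Frob /\ is_category Hstar /\
   exists (L : relFunctor Frob Hstar) (R : relFunctor Hstar Frob),
     adjoint L R /\
     forall B : hstarAlg, frob_magma (R B) = quot_magma B) /\
  (has_identities FrobRel /\ has_identities HstarRel /\
   exists (L : relFunctor FrobRel HstarRel) (R : relFunctor HstarRel FrobRel),
     adjoint L R /\
     forall B : hstarAlg, frob_magma (R B) = quot_magma B).
Proof.
have invK (X : relMagma) (G : groupoid_laws X) := respects_pseudoinv_diagonal G.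
have rel_id X : groupoid_laws X -> rel_condition X X (diagonal : set (X * X)).
  by move=> G; split; [apply/condR_diagonal/groupoid_axM|apply: invK].
have mor_id X : groupoid_laws X -> mor_condition X X (diagonal : set (X * X)).
  by move=> G; split; [exact: condP_diagonal|apply: invK].
have func_id X : groupoid_laws X -> func_condition X X (diagonal : set (X * X)).
  move=> G; split; [exact: condP_diagonal|exact: invK|].
  exact: has_right_adjoint_diagonal.
have rel_iso : iso_invariant rel_condition.
  move=> X X' Y Y' g h r gi hi [Rr Ir].
  by split; [exact: condR_iso|exact: respects_pseudoinv_iso].
have mor_iso : iso_invariant mor_condition.
  move=> X X' Y Y' g h r gi hi [Pr Ir].
  by split; [exact: condP_iso|exact: respects_pseudoinv_iso].
have func_iso : iso_invariant func_condition.
  move=> X X' Y Y' g h r gi hi [Pr Ir Ar].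
  by split; [exact: condP_iso|exact: respects_pseudoinv_iso|
             exact: has_right_adjoint_iso Ar].
have mor_comp : comp_closed mor_condition.
  move=> X Y Z r s G [Pr Ir] [Ps Is].
  by split; [exact: condP_comp|exact: respects_pseudoinv_comp].
have func_comp : comp_closed func_condition.
  move=> X Y Z r s G [Pr Ir Ar] [Ps Is As].
  by split; [exact: condP_comp|exact: respects_pseudoinv_comp|
             exact: has_right_adjoint_comp].
(* Only the morphisms are rewritten: [frob_magma (R B)] is well typed because the
   objects are [frobAlg] by computation. *)
rewrite -[FrobFunc]/(@RelCat frobAlg id (@hom FrobFunc)) FrobFunc_homE.
rewrite -[Frob]/(@RelCat frobAlg id (@hom Frob)) Frob_homE.
rewrite -[FrobRel]/(@RelCat frobAlg id (@hom FrobRel)) FrobRel_homE.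
split; last split; split.
- exact: (frob_catP func_id func_comp).
- split; first exact: (hstar_catP func_id func_comp).
  exact: (quot_adjunction_exists func_id func_iso).
- exact: (frob_catP mor_id mor_comp).
- split; first exact: (hstar_catP mor_id mor_comp).
  exact: (quot_adjunction_exists mor_id mor_iso).
- exact: (frob_cat_id rel_id).
- split; first exact: (hstar_cat_id rel_id).
  exact: (quot_adjunction_exists rel_id rel_iso).
Qed.
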